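(* For $x\ge 1$ let $$T_{2}(x):=\sum_{\substack{m_{1}m_{2}\leq x \\ m_{1}m_{2}\in N_{2}}}s(m_{1},m_{2}),$$ where the sum is over ordered pairs $(m_1,m_2)$ of positive integers with $m_1m_2\le x$ and $m_1m_2$ a perfect square. Then there is an absolute constant $c_{2}$ such that, for every $\varepsilon>0$, $$T_{2}(x)=c_{2}x+O(x^{19/28+\varepsilon}),$$ where the implied constant depends at most on $\varepsilon$.
   Context: $\mathbb{Z}_m$ denotes the additive group of residue classes modulo $m$. For positive integers $m_1,m_2$, $s(m_1,m_2)$ denotes the total number of subgroups of the group $\mathbb{Z}_{m_1}\times\mathbb{Z}_{m_2}$. $N_k$ denotes the set of $k$-th powers of natural numbers; here $k=2$. $\varepsilon$ denotes an arbitrarily small positive number. *)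

(* Defs.v *)
From HB Require Import structures.
From mathcomp Require Import all_boot all_order all_algebra all_fingroup.
From mathcomp Require Import all_classical all_reals all_analysis.
Set Implicit Arguments.
Unset Strict Implicit.
Unset Printing Implicit Defensive.
Import Order.TTheory GRing.Theory Num.Theory.
Local Open Scope ring_scope.

(* The ambient type 'Z_m is only correct for 1 < m; the group Zp m is all of  *)
(* 'Z_m when 1 < m and trivial when m = 1, so it is the additive group of     *)
(* residues modulo m for every m > 0.                                         *)
Definition num_subgroups (m1 m2 : nat) : nat :=
  #|subgroups (finset.setX (Zp m1) (Zp m2))|.

Definition kth_powers (k : nat) : set nat :=
  [set n | exists r : nat, n = (r ^ k)%N]%classic.

(* Bounding both indices by the integer part of x loses no pair, since        *)
(* m1, m2 <= m1 * m2 <= x.                                                    *)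
Definition subgroup_sum (R : realType) (k : nat) (x : R) : R :=
  \sum_(1 <= m1 < (Num.truncn x).+1) \sum_(1 <= m2 < (Num.truncn x).+1
      | ((m1 * m2)%:R <= x) && ((m1 * m2)%N \in kth_powers k))
    (num_subgroups m1 m2)%:R.

(* Main.v *)
(* A subgroup of Z_m x Z_n is a lattice generated by (a, t) and (0, b) modulo
   (m, n), so s(m, n) = \sum_(a | m, b | n) gcd(a, b).  Expanding the gcd with
   Euler's phi, and splitting a square factor off one of the four divisors,
   gives \sum_(m1 m2 = r^2) s(m1, m2) = \sum_(d | r) d h(r / d), where h >= 0
   counts the factorisations u u' v v' = e^2 with u squarefree.  With
   y = sqrt x, summing the d first leaves
     T(x) = \sum_(e <= y) h(e) ((y / e)^2 / 2 + O(y / e)),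
   and both the error terms and the tail of \sum h(e) / e^2 are O(y^s) as soon
   as \sum h(e) e^(-s) converges.  This holds for every s > 1, because
   h <= tau^6 and, tau being submultiplicative,
   \sum tau(n)^(k+1) n^(-s) <= (\sum tau(n)^k n^(-s))^2.  Take s = 19/14. *)

Require Import Defs.
From HB Require Import structures.
From mathcomp Require Import all_boot all_order all_algebra all_fingroup.
From mathcomp Require Import all_solvable.
From mathcomp Require Import all_classical all_reals all_analysis.
From mathcomp Require Import zify lra ring.
Set Implicit Arguments.
Unset Strict Implicit.
Unset Printing Implicit Defensive.
Import Order.TTheory GRing.Theory Num.Theory.
Local Open Scope ring_scope.

(** * Lattices in Hermite normal form *)

Section LatticeTriples.
Local Open Scope nat_scope.

(* The lattice generated by (a, t) and (0, b), seen on pairs of naturals. *)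
Definition hermite (a b t x y : nat) : bool :=
  (a %| x) && (y == x %/ a * t %[mod b]).

(** The divisibilities say that (m, 0) and (0, n) lie in the lattice; [t < b] selects one generator
    (a, t) per lattice. *)
Definition hermite_valid (m n a b t : nat) : bool :=
  [&& a %| m, b %| n, t < b & b %| m %/ a * t].

Lemma hermiteD a b t x y x' y' : hermite a b t x y -> hermite a b t x' y' ->
  hermite a b t (x + x') (y + y').
Proof.
move=> /andP[ax /eqP e] /andP[ax' /eqP e']; rewrite /hermite dvdn_add //=.
by rewrite divnDl // mulnDl -modnDm e e' modnDm.
Qed.

Lemma hermite_mod m n a b t x y : hermite_valid m n a b t ->
  hermite a b t (x %% m) (y %% n) = hermite a b t x y.
Proof.
case/and4P=> am bn _ bmt; rewrite /hermite.
have -> : (a %| x %% m) = (a %| x).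
  by rewrite {2}(divn_eq x m) dvdn_addr // dvdn_mull.
have [ax|//] := boolP (a %| x); rewrite /= modn_dvdm //.
rewrite {2}(divn_eq x m) divnDl ?dvdn_mull // mulnDl -muln_divA // -mulnA.
by rewrite -(modnDml (_ * _)) (eqP (dvdn_mull _ bmt)).
Qed.

(** Each of (a, t) and (a', t') lies in both lattices, so a and a' divide each other. The points
    with x = 0 recover b, and then t is fixed modulo b. *)
Lemma hermite_inj m n a b t a' b' t' :
    hermite_valid m n a b t -> hermite_valid m n a' b' t' ->
    0 < a -> 0 < a' -> hermite a b t =2 hermite a' b' t' ->
  [/\ a = a', b = b' & t = t'].
Proof.
move=> /and4P[_ _ tb _] /and4P[_ _ tb' _] a0 a'0 eqh.
have ata c d s : 0 < c -> hermite c d s c s.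
  by move=> c0; rewrite /hermite dvdnn divnn c0 mul1n /=.
have b0 c d s y : hermite c d s 0 y = (d %| y).
  by rewrite /hermite dvdn0 div0n mul0n mod0n.
have eqa : a = a'.
  apply/eqP; rewrite eqn_dvd.
  have /andP[-> _] : hermite a' b' t' a t by rewrite -eqh ata.
  by have /andP[-> _] : hermite a b t a' t' by rewrite eqh ata.
have eqb : b = b'.
  apply/eqP; rewrite eqn_dvd.
  by rewrite -(b0 a b t) eqh b0 dvdnn -(b0 a' b' t') -eqh b0 dvdnn.
split=> //; have /andP[_ /eqP] : hermite a' b' t' a t by rewrite -eqh ata.
by rewrite eqa divnn a'0 mul1n -eqb !modn_small // eqb.
Qed.

End LatticeTriples.

(** * Subgroups of a product of two cyclic groups *)

Section Subgroups.
Local Open Scope nat_scope.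
Variables m n : nat.
Hypotheses (m0 : (0 < m)%N) (n0 : (0 < n)%N).

(** ['Z_1] has two elements, so reducing modulo [p] first is what keeps the value in [Zp p] when
    [p = 1]. *)
Definition Zp_of_nat (p x : nat) : 'Z_p := inZp (x %% p)%N.

Lemma val_Zp_of_nat p x : (0 < p)%N -> Zp_of_nat p x = (x %% p)%N :> nat.
Proof.
move=> p0; rewrite /= modn_small //; apply: leq_trans (ltn_pmod _ p0) _.
by rewrite /Zp_trunc; case: p p0 => [|[|p]].
Qed.

Lemma in_Zp_lt p (u : 'Z_p) : (0 < p)%N -> (u \in Zp p) = (u < p)%N.
Proof.
rewrite /Zp; case: p u => [|[|p]] //= u _; last by rewrite finset.in_setT ltn_ord.
by rewrite inE; apply/eqP/idP => [->|] //; case: u => [[|k] i] //= _; apply: val_inj.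
Qed.

Lemma Zp_of_natP p x : (0 < p)%N -> Zp_of_nat p x \in Zp p.
Proof. by move=> p0; rewrite in_Zp_lt // val_Zp_of_nat // ltn_pmod. Qed.

Lemma Zp_of_natK p (u : 'Z_p) : (0 < p)%N -> u \in Zp p -> Zp_of_nat p u = u.
Proof.
by move=> p0; rewrite in_Zp_lt // => up; apply: ord_inj; rewrite val_Zp_of_nat // modn_small.
Qed.

Lemma Zp_of_natD p x y : (0 < p)%N ->
  (Zp_of_nat p x * Zp_of_nat p y)%g = Zp_of_nat p (x + y).
Proof.
move=> p0; apply: ord_inj; rewrite val_Zp_of_nat //.
transitivity ((Zp_of_nat p x + Zp_of_nat p y) %% (Zp_trunc p).+2)%N; first by [].
by rewrite !val_Zp_of_nat //; case: p p0 => [|[|p]] // _; rewrite ?modn1 // modnDm.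
Qed.

Lemma eq_Zp_of_nat p x y : (0 < p)%N -> x = y %[mod p] -> Zp_of_nat p x = Zp_of_nat p y.
Proof. by move=> p0 e; apply: ord_inj; rewrite !val_Zp_of_nat. Qed.

Notation G := (finset.setX (Zp m) (Zp n)).

Definition elt (x y : nat) : 'Z_m * 'Z_n := (Zp_of_nat m x, Zp_of_nat n y).

Lemma eltD x y x' y' : (elt x y * elt x' y')%g = elt (x + x') (y + y').
Proof. by rewrite /elt -!Zp_of_natD. Qed.

Lemma eltK u : u \in G -> elt u.1 u.2 = u.
Proof.
by case: u => u v /finset.setXP[hu hv]; rewrite /elt /= !Zp_of_natK.
Qed.

Lemma elt_in x y : elt x y \in G.
Proof. by rewrite finset.in_setX !Zp_of_natP. Qed.

Definition hermite_set (a b t : nat) : {set 'Z_m * 'Z_n} :=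
  [set u in G | hermite a b t u.1 u.2].

Lemma elt_hermite_set a b t x y : hermite_valid m n a b t ->
  (elt x y \in hermite_set a b t) = hermite a b t x y.
Proof.
by move=> v; rewrite inE elt_in !val_Zp_of_nat // (hermite_mod _ _ v).
Qed.

Lemma hermite_set_group a b t : hermite_valid m n a b t ->
  group_set (hermite_set a b t).
Proof.
move=> v; apply/group_setP; split=> [|u w].
  have -> : (1 = elt 0 0)%g by congr (_, _); apply: val_inj; rewrite /= ?mod0n.
  by rewrite elt_hermite_set // /hermite dvdn0 div0n mul0n mod0n eqxx.
move=> uh wh; have uG : u \in G by move: uh; rewrite inE => /andP[].
have wG : w \in G by move: wh; rewrite inE => /andP[].
rewrite -(eltK uG) -(eltK wG) in uh wh *.
rewrite eltD elt_hermite_set //; apply: hermiteD; by rewrite -elt_hermite_set.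
Qed.

(** Lift H to pairs of naturals. Then a is the least positive first coordinate, b the least positive
    number with (0, b) in the lift, and t a second coordinate over a, reduced modulo b. Euclidean
    division shows that nothing else is needed. *)
Lemma subgroup_hermite (H : {group 'Z_m * 'Z_n}) : H \subset G ->
  exists a b t : nat, hermite_valid m n a b t /\ (H :=: hermite_set a b t)%g.
Proof.
move=> HG; pose P x y := elt x y \in H.
have PD x y x' y' : P x y -> P x' y' -> P (x + x')%N (y + y')%N.
  by move=> p p'; rewrite /P -eltD groupM.
(* Coordinates are naturals, so cancellation stands in for subtraction. *)
have PB x y x' y' : P (x + x')%N (y + y')%N -> P x' y' -> P x y.
  by move=> p p'; move: p; rewrite /P -eltD groupMr.
have Pm x y k l : P (x + k * m)%N (y + l * n)%N = P x y.
  rewrite /P /elt (@eq_Zp_of_nat m (x + k * m) x) ?(@eq_Zp_of_nat n (y + l * n) y) //.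
    by rewrite addnC modnMDl.
  by rewrite addnC modnMDl.
have Pn x y l : P x (y + l * n)%N = P x y.
  by have := Pm x y 0%N l; rewrite mul0n addn0.
have P00 : P 0%N 0%N.
  rewrite /P (_ : elt 0 0 = 1%g) ?group1 //.
  by congr (_, _); apply: val_inj; rewrite /= ?mod0n.
have Pm0 : P m 0%N by have := Pm 0%N 0%N 1%N 0%N; rewrite mul1n mul0n add0n P00.
have P0n : P 0%N n by have := Pn 0%N 0%N 1%N; rewrite mul1n add0n P00.
have PM k x y : P x y -> P (k * x)%N (k * y)%N.
  by move=> p; elim: k => [|k IH]; rewrite ?mul0n // !mulSn PD.
have exA : exists a, (0 < a)%N && [exists y : 'I_n, P a y].
  by exists m; rewrite m0; apply/existsP; exists (Ordinal n0).
have [a /andP[a0 /existsP[t0 Pat0]] amin] := ex_minnP exA.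
have exB : exists b, (0 < b)%N && P 0%N b.
  by exists n; rewrite n0.
have [b /andP[b0 P0b] bmin] := ex_minnP exB.
have bP y : P 0%N y = (b %| y)%N.
  apply/idP/idP => [p|/dvdnP[k ->]]; last by rewrite -(muln0 k) PM.
  rewrite /dvdn; case: posnP => // r0.
  suff : P 0%N (y %% b)%N by move=> pr; move: (bmin (y %% b)%N); rewrite r0 pr leqNgt ltn_pmod // => /(_ isT).
  apply: (@PB 0 (y %% b) (y %/ b * 0) (y %/ b * b))%N; last exact: PM.
  by rewrite muln0 addnC -divn_eq.
pose t := (t0 %% b)%N.
have Pat : P a t.
  apply: (@PB _ _ 0 (t0 %/ b * b))%N; last by rewrite bP dvdn_mull.
  by rewrite addn0 addnC -divn_eq.
have aP x y : P x y -> (a %| x)%N.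
  move=> p; rewrite /dvdn; case: posnP => // r0.
  pose q := (x %/ a)%N.
  (* Modulo n, adding [q * t * n.-1] subtracts q t. So this is (x, y) - q (a, t), whose first
     coordinate is below a, against minimality. *)
  have pr : P (x %% a)%N ((y + q * t * n.-1) %% n)%N.
    rewrite -(Pn _ _ ((y + q * t * n.-1) %/ n)) [_ %% n + _]addnC -divn_eq.
    apply: (@PB _ _ (q * a) (q * t))%N; last exact: PM.
    by rewrite [_ %% a + _]addnC -divn_eq -addnA -mulnSr prednK // Pn.
  have: (a <= x %% a)%N.
    apply: amin; rewrite r0; apply/existsP.
    by exists (Ordinal (ltn_pmod (y + q * t * n.-1) n0)).
  by rewrite leqNgt ltn_pmod.
have am : (a %| m)%N := aP _ _ Pm0.
have bn : (b %| n)%N by rewrite -bP.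
have bmt : (b %| m %/ a * t)%N.
  rewrite -bP; have := PM (m %/ a)%N _ _ Pat; rewrite divnK // => p.
  by rewrite -(Pm _ _ 1 0)%N mul0n mul1n add0n addn0.
have valid : hermite_valid m n a b t by rewrite /hermite_valid am bn ltn_pmod.
exists a, b, t; split=> //.
(* Subtracting x / a copies of (a, t) leaves a point with first coordinate 0, whose membership is
   divisibility by b. *)
have key x y : P x y = hermite a b t x y.
  rewrite /hermite; have [ax|nax] := boolP (a %| x)%N; last first.
    by apply: negbTE; apply: contra nax; apply: aP.
  have Pq := PM (x %/ a)%N _ _ Pat; rewrite divnK // in Pq.
  set s := (_ * t)%N in Pq *; apply/idP/eqP => [Pxy|e].
    have : P 0%N (y + s * n.-1)%N.
      apply: (@PB _ _ x s); last by [].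
      by rewrite add0n -addnA -mulnSr prednK // Pn.
    rewrite bP => bys; have e : y + s * n = s + (y + s * n.-1).
      by rewrite addnCA -mulnS prednK.
    transitivity ((y + s * n) %% b).
      by rewrite -modnDmr (eqP (dvdn_mull s bn)) addn0.
    by rewrite e -modnDmr (eqP bys) addn0.
  have [ys|/ltnW sy] := leqP y s.
    apply: (@PB _ _ 0 (s - y)%N); first by rewrite addn0 subnKC.
    by rewrite bP -eqn_mod_dvd // e.
  rewrite -(subnKC sy) -(addn0 x); apply: PD => //.
  by rewrite bP -eqn_mod_dvd // e.
apply/setP=> u; have [uG|nuG] := boolP (u \in G).
  by rewrite -(eltK uG) elt_hermite_set // -key.
by rewrite inE (negbTE nuG); apply: negbTE; apply: contra nuG; apply: (fintype.subsetP HG).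
Qed.

(** Existence and uniqueness of the normal form make valid triples correspond to subgroups. The
    ordinal bounds lose nothing, since a <= m and t < b <= n. *)
Lemma num_subgroups_triples : num_subgroups m n =
  #|[set p : 'I_m.+1 * 'I_n.+1 * 'I_n.+1 | hermite_valid m n p.1.1 p.1.2 p.2]|.
Proof.
(* Taking the generated group makes [f] total; on valid triples it changes nothing. *)
pose f (p : 'I_m.+1 * 'I_n.+1 * 'I_n.+1) := <<hermite_set p.1.1 p.1.2 p.2>>%G.
rewrite /num_subgroups.
have fE (p : 'I_m.+1 * 'I_n.+1 * 'I_n.+1) : hermite_valid m n p.1.1 p.1.2 p.2 ->
    f p = hermite_set p.1.1 p.1.2 p.2 :> {set _}.
  by move=> v; rewrite /= (gen_set_id (hermite_set_group v)).
rewrite -(@card_in_imset _ _ f); last first.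
  move=> [[a b] t] [[a' b'] t']; rewrite !inE /= => v v' e.
  have eqs : hermite_set a b t = hermite_set a' b' t'.
    by rewrite -(fE (a, b, t)) // -(fE (a', b', t')) // e.
  have pos (c : 'I_m.+1) d s : hermite_valid m n c d s -> (0 < c)%N.
    by case/and4P=> /dvdn_gt0 -> //.
  have [|/val_inj-> /val_inj-> /val_inj->] // := hermite_inj v v' (pos _ _ _ v) (pos _ _ _ v').
  by move=> x y; rewrite -!elt_hermite_set // eqs.
congr #|pred_of_set _|; apply/setP=> H; rewrite inE; apply/idP/imsetP => [HG|[p]].
  have [a [b [t [v HE]]]] := subgroup_hermite HG.
  have /and4P[am bn tb _] := v.
  have la : (a < m.+1)%N by rewrite ltnS dvdn_leq.
  have lb : (b < n.+1)%N by rewrite ltnS dvdn_leq.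
  have lt : (t < n.+1)%N by apply: leq_trans tb (ltnW lb).
  exists (Ordinal la, Ordinal lb, Ordinal lt); first by rewrite inE.
  by apply: val_inj; rewrite [LHS]HE; symmetry; apply: fE.
rewrite inE => v ->; apply/fintype.subsetP => u hu.
have : u \in hermite_set p.1.1 p.1.2 p.2 by rewrite -(fE _ v).
by rewrite inE => /andP[].
Qed.

End Subgroups.

(** * Reindexing sums over divisors *)

Section DivisorSums.
Local Open Scope nat_scope.

Lemma sum_divisors_ord n (F : nat -> nat) : 0 < n ->
  \sum_(d < n.+1 | d %| n) F d = \sum_(d <- divisors n) F d.
Proof.
move=> n0; rewrite -(big_mkord (fun d => d %| n) F) -big_filter.
apply/perm_big/uniq_perm; rewrite ?filter_uniq ?iota_uniq ?divisors_uniq // => d.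
rewrite mem_filter mem_index_iota -dvdn_divisors // andbC /=.
by rewrite ltnS; case: (boolP (d %| n)) => [/dvdn_leq ->|]; rewrite ?andbF.
Qed.

Lemma sum_divisors_pred_range (V : nmodType) n N (F : nat -> V) : 0 < n <= N ->
  (\sum_(d <- divisors n) F d = \sum_(1 <= d < N.+1 | (d %| n)%N) F d)%R.
Proof.
case/andP=> n0 nN; rewrite -[RHS]big_filter.
apply/perm_big/uniq_perm; rewrite ?filter_uniq ?iota_uniq ?divisors_uniq // => d.
rewrite mem_filter mem_index_iota -dvdn_divisors //.
case: (boolP (d %| n)) => //= dn.
by rewrite (dvdn_gt0 n0 dn) ltnS (leq_trans (dvdn_leq n0 dn) nN).
Qed.

(** The substitution m = c u serves twice: for the multiples of d dividing n, and for the m such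
    that d divides both m and r^2 / m. *)
Lemma sum_divisors_image N M c (P : pred nat) (F : nat -> nat) :
    0 < N -> 0 < M -> 0 < c ->
    (forall u, u %| M -> (c * u %| N) && P (c * u)) ->
    (forall m, m %| N -> P m -> exists2 u, m = c * u & u %| M) ->
  \sum_(m <- divisors N | P m) F m = \sum_(u <- divisors M) F (c * u).
Proof.
move=> N0 M0 c0 h1 h2; rewrite -big_filter -(big_map (fun u => c * u) xpredT F).
apply/perm_big/uniq_perm; rewrite ?filter_uniq ?divisors_uniq //.
  rewrite map_inj_uniq ?divisors_uniq // => u v /eqP.
  by rewrite eqn_pmul2l // => /eqP.
move=> m; rewrite mem_filter -dvdn_divisors //; apply/andP/mapP.
  by case=> Pm mN; have [u -> uM] := h2 m mN Pm; exists u; rewrite -?dvdn_divisors.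
by case=> u; rewrite -dvdn_divisors // => uM ->; have /andP[-> ->] := h1 u uM.
Qed.

Lemma sum_divisors_multiples n d (F : nat -> nat) : 0 < n -> d %| n ->
  \sum_(m <- divisors n | d %| m) F m = \sum_(u <- divisors (n %/ d)) F (d * u).
Proof.
move=> n0 dn; have d0 := dvdn_gt0 n0 dn.
case/dvdnP: dn n0 => e ->; rewrite muln_gt0 => /andP[e0 _].
rewrite mulnK //; apply: sum_divisors_image => // [|u ue|m mN /dvdnP[u eu]].
- by rewrite muln_gt0 e0.
- by rewrite mulnC dvdn_pmul2r // ue mulnC dvdn_mulr.
- by exists u; [rewrite mulnC | move: mN; rewrite eu dvdn_pmul2r].
Qed.

Lemma sum_divisors_sub n N (P : pred nat) (F : nat -> nat) : 0 < n -> 0 < N ->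
    (forall d, d %| n -> P d -> d %| N) ->
  \sum_(d <- divisors n | P d) F d = \sum_(d <- divisors N | (d %| n) && P d) F d.
Proof.
move=> n0 N0 h; rewrite -big_filter -[RHS]big_filter.
apply/perm_big/uniq_perm; rewrite ?filter_uniq ?divisors_uniq // => d.
rewrite !mem_filter -!dvdn_divisors // andbC.
case: (boolP (d %| n)) => //= dn; case: (boolP (P d)) => //= Pd.
by rewrite h.
Qed.

Lemma sum_divisors_rev n (F : nat -> nat) : 0 < n ->
  \sum_(d <- divisors n) F (n %/ d) = \sum_(d <- divisors n) F d.
Proof.
move=> n0; rewrite -(big_map (fun d => n %/ d) xpredT F).
apply/perm_big/uniq_perm; rewrite ?divisors_uniq //.
  rewrite map_inj_in_uniq ?divisors_uniq // => d e.
  rewrite -!dvdn_divisors // => dn en eq.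
  by move: (divnK dn) (divnK en); rewrite eq; nia.
move=> d; rewrite -dvdn_divisors //; apply/mapP/idP.
  by case=> e; rewrite -dvdn_divisors // => en ->; apply: dvdn_div.
by move=> dn; exists (n %/ d); rewrite -?dvdn_divisors ?dvdn_div // divnA ?mulKn.
Qed.

(** Both sides run over the chains d | m | n, with k = m / d. This supplies the associativity of
    Dirichlet convolution used below. *)
Lemma sum_divisors_divisors n (F : nat -> nat -> nat) : 0 < n ->
  \sum_(m <- divisors n) \sum_(d <- divisors m) F d (m %/ d) =
  \sum_(d <- divisors n) \sum_(k <- divisors (n %/ d)) F d k.
Proof.
move=> n0; transitivity (\sum_(m <- divisors n) \sum_(d <- divisors n | d %| m) F d (m %/ d)).
  rewrite big_seq [RHS]big_seq; apply: eq_bigr => m; rewrite -dvdn_divisors // => mn.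
  rewrite (@sum_divisors_sub m n) ?(dvdn_gt0 n0 mn) //; last first.
    by move=> d dm _; apply: dvdn_trans mn.
  by apply: eq_bigl => d; rewrite andbT.
rewrite (exchange_big_dep xpredT) //= big_seq [RHS]big_seq.
apply: eq_bigr => d; rewrite -dvdn_divisors // => dn.
rewrite sum_divisors_multiples //; apply: eq_bigr => u _.
by rewrite mulKn // (dvdn_gt0 n0 dn).
Qed.

Lemma sum_totient_divisors n : 0 < n -> \sum_(d <- divisors n) totient d = n.
Proof. by move=> n0; rewrite -sum_divisors_ord // sum_totient_dvd. Qed.

Lemma sum_range_multiples (V : nmodType) N a (F : nat -> V) : 0 < a ->
  (\sum_(1 <= n < N.+1 | (a %| n)%N) F n = \sum_(1 <= b < (N %/ a)%N.+1) F (a * b)%N)%R.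
Proof.
move=> a0; rewrite -big_filter -(big_map (fun u => a * u) xpredT F).
apply/perm_big/uniq_perm; rewrite ?filter_uniq ?iota_uniq //.
  rewrite map_inj_uniq ?iota_uniq // => u v /eqP.
  by rewrite eqn_pmul2l // => /eqP.
move=> n; rewrite mem_filter mem_index_iota; apply/andP/mapP.
  case=> /dvdnP[b ->] /andP[ba0 baN]; exists b; last by rewrite mulnC.
  rewrite mem_index_iota ltnS leq_divRL // -[X in _ && X]ltnS baN andbT.
  by move: ba0; rewrite muln_gt0 => /andP[].
case=> b; rewrite mem_index_iota ltnS leq_divRL // => /andP[b0 bN] ->.
by rewrite dvdn_mulr // muln_gt0 a0 b0 ltnS mulnC.
Qed.

(** Both sides run over the pairs of positive integers with a b <= N. *)
Lemma sum_range_divisors (V : nmodType) N (F : nat -> nat -> V) :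
  (\sum_(1 <= n < N.+1) \sum_(a <- divisors n) F a (n %/ a)%N =
  \sum_(1 <= a < N.+1) \sum_(1 <= b < (N %/ a)%N.+1) F a b)%R.
Proof.
transitivity (\sum_(1 <= n < N.+1) \sum_(1 <= a < N.+1 | (a %| n)%N) F a (n %/ a)%N)%R.
  apply: eq_big_nat => n /andP[n0 nN].
  by rewrite (@sum_divisors_pred_range _ _ N) ?n0.
rewrite (exchange_big_dep xpredT) //=; apply: eq_big_nat => a /andP[a0 _].
by rewrite sum_range_multiples //; apply: eq_bigr => b _; rewrite mulKn.
Qed.

End DivisorSums.

(** * The divisor function and squarefree parts *)

Section Tau.
Local Open Scope nat_scope.

Definition tau (n : nat) : nat := size (divisors n).

Lemma tauE n : tau n = \sum_(d <- divisors n) 1.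
Proof. by rewrite sum1_size. Qed.

Lemma tau_dvd d n : 0 < n -> d %| n -> tau d <= tau n.
Proof.
move=> n0 dn; apply: uniq_leq_size (divisors_uniq _) _ => e.
rewrite -!dvdn_divisors ?(dvdn_gt0 n0 dn) // => ed; exact: dvdn_trans dn.
Qed.

(** A divisor d of a b is the product of gcd(d, a), which divides a, and d / gcd(d, a), which
    divides b by Gauss's lemma. *)
Lemma tau_mul a b : 0 < a -> 0 < b -> tau (a * b) <= tau a * tau b.
Proof.
move=> a0 b0; rewrite -(size_allpairs muln).
apply: uniq_leq_size (divisors_uniq _) _ => d.
rewrite -dvdn_divisors ?muln_gt0 ?a0 // => dab.
have g0 : 0 < gcdn d a by rewrite gcdn_gt0 a0 orbT.
apply/allpairsP; exists (gcdn d a, d %/ gcdn d a); rewrite -!dvdn_divisors //=.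
split; [exact: dvdn_gcdr | | by rewrite mulnC divnK ?dvdn_gcdl].
have cop : coprime (d %/ gcdn d a) (a %/ gcdn d a).
  rewrite /coprime -(eqn_pmul2r g0) muln_gcdl mul1n.
  by rewrite !divnK ?dvdn_gcdl ?dvdn_gcdr.
rewrite -(Gauss_dvdr _ cop) -(dvdn_pmul2r g0) divnK ?dvdn_gcdl //.
by rewrite mulnAC divnK ?dvdn_gcdr.
Qed.

Definition squarefree (n : nat) : bool :=
  all (fun d => (d ^ 2 %| n) ==> (d == 1)) (divisors n).

Lemma squarefreeP n : 0 < n ->
  reflect (forall d, d ^ 2 %| n -> d = 1) (squarefree n).
Proof.
move=> n0; apply: (iffP allP) => [h d dn|h d _]; last first.
  by apply/implyP => /h ->.
have dn' : d %| n by apply: dvdn_trans dn; apply: dvdn_mulr.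
by have /implyP/(_ dn)/eqP := h d (etrans (esym (dvdn_divisors d n0)) dn').
Qed.

(** With g = gcd(k, l), the square of k / g is coprime to that of l / g, hence divides z, and so k =
    g. Applied both ways, this gives uniqueness of the square part. *)
Lemma squarefree_kernel_le v k w l z : 0 < v -> v = k ^ 2 * w -> v = l ^ 2 * z ->
  squarefree z -> k %| l.
Proof.
move=> v0 vk vl; have w0 : 0 < w by move: v0; rewrite vk muln_gt0 => /andP[].
have z0 : 0 < z by move: v0; rewrite vl muln_gt0 => /andP[].
have k0 : 0 < k by move: v0; rewrite vk muln_gt0 expn_gt0 orbF => /andP[].
move/(squarefreeP z0) => sqz; set g := gcdn k l.
have g0 : 0 < g by rewrite gcdn_gt0 k0.
have kE : k = g * (k %/ g) by rewrite mulnC divnK ?dvdn_gcdl.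
have lE : l = g * (l %/ g) by rewrite mulnC divnK ?dvdn_gcdr.
have cop : coprime (k %/ g) (l %/ g).
  rewrite /coprime -(eqn_pmul2r g0) muln_gcdl mul1n.
  by rewrite !divnK ?dvdn_gcdl ?dvdn_gcdr.
have e : (k %/ g) ^ 2 * w = (l %/ g) ^ 2 * z.
  apply/eqP; rewrite -(@eqn_pmul2l (g ^ 2)) ?expn_gt0 ?g0 //.
  by rewrite 2!(mulnA (g ^ 2)) -!expnMn -kE -lE -vk -vl.
have : (k %/ g) ^ 2 %| z.
  by rewrite -(@Gauss_dvdr _ ((l %/ g) ^ 2)) ?coprimeXl ?coprimeXr // -e dvdn_mulr.
by move/sqz => k1; rewrite kE k1 muln1 dvdn_gcdr.
Qed.

(** Take the largest k: a square d^2 dividing the quotient would make d k a competitor. *)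
Lemma squarefree_decomposition v : 0 < v ->
  exists2 k, k ^ 2 %| v & squarefree (v %/ k ^ 2).
Proof.
move=> v0; have ex : exists k, k ^ 2 %| v by exists 1; rewrite dvd1n.
have bnd k : k ^ 2 %| v -> k <= v.
  by move=> /(dvdn_leq v0); nia.
case: (ex_maxnP ex bnd) => k kv kmax; exists k => //.
have k0 : 0 < k by case: k kv {kmax} => //; rewrite dvd0n; case: v v0 {ex bnd}.
apply/squarefreeP => [|d]; first by rewrite divn_gt0 ?expn_gt0 ?k0 // dvdn_leq.
rewrite dvdn_divRL // -expnMn => dkv.
have : 0 < d * k by case: (d * k) dkv => //; rewrite dvd0n; case: v v0 {ex bnd kv kmax}.
by move: (kmax _ dkv); nia.
Qed.

(** Exactly one k leaves a squarefree quotient. The free parameter E lets one index set serve many v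
    at once. *)
Lemma sum_squarefree v E : 0 < v -> 0 < E -> (forall k, k ^ 2 %| v -> k %| E) ->
  \sum_(k <- divisors E | k ^ 2 %| v) squarefree (v %/ k ^ 2) = 1.
Proof.
move=> v0 E0 vE; have [k kv sqk] := squarefree_decomposition v0.
rewrite big_mkcond (bigD1_seq k) ?divisors_uniq -?dvdn_divisors ?vE //= kv sqk.
rewrite big1_seq // => l /andP[lk _]; case: ifP => // lv.
apply/eqP; rewrite eqb0; apply: contra lk => sql.
have ek : v = k ^ 2 * (v %/ k ^ 2) by rewrite mulnC divnK.
have el : v = l ^ 2 * (v %/ l ^ 2) by rewrite mulnC divnK.
by rewrite eqn_dvd (squarefree_kernel_le v0 el ek) ?(squarefree_kernel_le v0 ek el).
Qed.

(** For n > 0 this is 2^omega(n), where omega counts distinct prime factors. *)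
Definition sqf_tau (n : nat) : nat := \sum_(d <- divisors n) squarefree d.

Lemma sqf_tau_le n : sqf_tau n <= tau n.
Proof. by rewrite tauE; apply: leq_sum => d _; case: squarefree. Qed.

(** Each divisor v of u is uniquely k^2 w with w squarefree, and then w divides u / k^2. From k^2 |
    u | e^2 follows k | e. *)
Lemma tau_sqf u e : 0 < e -> u %| e ^ 2 ->
  tau u = \sum_(k <- divisors e | k ^ 2 %| u) sqf_tau (u %/ k ^ 2).
Proof.
move=> e0 ue; have u0 : 0 < u by apply: dvdn_gt0 ue; rewrite expn_gt0 e0.
transitivity (\sum_(v <- divisors u) \sum_(k <- divisors e | k ^ 2 %| v)
    squarefree (v %/ k ^ 2)).
  rewrite tauE big_seq [RHS]big_seq; apply: eq_bigr => v.
  rewrite -dvdn_divisors // => vu; rewrite sum_squarefree ?(dvdn_gt0 u0 vu) //.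
  move=> k kv; rewrite -(@dvdn_pexp2r _ _ 2) //.
  exact: dvdn_trans kv (dvdn_trans vu ue).
rewrite (exchange_big_dep xpredT) //= [RHS]big_mkcond; apply: eq_bigr => k _.
case: ifP => ku.
  rewrite sum_divisors_multiples //; apply: eq_bigr => w _.
  by rewrite mulKn //; apply: dvdn_gt0 ku.
rewrite big1_seq // => v /andP[kv]; rewrite -dvdn_divisors // => vu.
by rewrite (dvdn_trans kv vu) in ku.
Qed.

End Tau.

(** * Subgroup counts summed over the factorisations of a square *)

Section SquareConvolution.
Local Open Scope nat_scope.

Lemma count_multiples_below k b : 0 < b -> \sum_(t < b) (b %| k * t) = gcdn k b.
Proof.
move=> b0; have g0 : 0 < gcdn k b by rewrite gcdn_gt0 b0 orbT.
set g := gcdn k b; pose c := b %/ g.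
have bE : b = c * g by rewrite divnK ?dvdn_gcdr.
have c0 : 0 < c by move: b0; rewrite bE muln_gt0 => /andP[].
have eqc t : (b %| k * t) = (c %| t).
  have kE : k = k %/ g * g by rewrite divnK ?dvdn_gcdl.
  have cop : coprime c (k %/ g).
    rewrite /coprime gcdnC -(eqn_pmul2r g0) muln_gcdl mul1n.
    by rewrite !divnK ?dvdn_gcdl ?dvdn_gcdr.
  by rewrite {1}bE kE mulnAC dvdn_pmul2r // Gauss_dvdr.
under eq_bigr do rewrite eqc.
rewrite -(big_mkord xpredT (fun t => (c %| t) : nat)) big_ltn // dvdn0.
(* The ranges 0..b-1 and 1..b differ by trading 0 for b, both multiples of c. *)
have : \sum_(1 <= t < b.+1) (c %| t) = g by rewrite -divn_count_dvd bE mulKn.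
have cb : c %| b by rewrite bE dvdn_mulr.
by rewrite big_nat_recr //= cb addnC.
Qed.

(** For given a and b there are gcd(m / a, b) admissible t; replacing a by m / a gives the symmetric
    form. *)
Lemma num_subgroups_gcd m n : 0 < m -> 0 < n -> num_subgroups m n =
  \sum_(a <- divisors m) \sum_(b <- divisors n) gcdn a b.
Proof.
move=> m0 n0; rewrite num_subgroups_triples // -sum1_card.
rewrite -(@sum_divisors_rev m (fun a => \sum_(b <- divisors n) gcdn a b)) //.
rewrite -sum_divisors_ord // big_mkcond.
transitivity (\sum_(a < m.+1) \sum_(b < n.+1) \sum_(t < n.+1)
    hermite_valid m n a b t).
  rewrite big_mkcond !pair_big /=; apply: eq_bigr => p _.
  by rewrite inE; case: hermite_valid.
rewrite [RHS]big_mkcond; apply: eq_bigr => a _; rewrite -sum_divisors_ord //.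
case: (boolP (a %| m)) => am; last first.
  by rewrite big1 // => b _; rewrite big1 // => t _; rewrite /hermite_valid (negbTE am).
rewrite [RHS]big_mkcond; apply: eq_bigr => b _.
case: (boolP (b %| n)) => bn; last first.
  by rewrite big1 // => t _; rewrite /hermite_valid (negbTE bn) andbF.
have b0 := dvdn_gt0 n0 bn.
rewrite -(count_multiples_below _ b0) (big_ord_widen n.+1 (fun t => (b %| m %/ a * t) : nat)).
  by rewrite [RHS]big_mkcond; apply: eq_bigr => t _; rewrite /hermite_valid am bn; case: ltnP.
by rewrite ltnW // ltnS dvdn_leq.
Qed.

(** Write gcd(a, b) as the sum of [totient d] over the common divisors d; for fixed d, a and b then
    range freely over multiples of d. *)
Lemma num_subgroups_totient m n : 0 < m -> 0 < n -> num_subgroups m n =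
  \sum_(d <- divisors m | d %| n) totient d * (tau (m %/ d) * tau (n %/ d)).
Proof.
move=> m0 n0; rewrite num_subgroups_gcd //.
transitivity (\sum_(a <- divisors m) \sum_(b <- divisors n)
    \sum_(d <- divisors m | (d %| a) && (d %| b)) totient d).
  rewrite big_seq [RHS]big_seq; apply: eq_bigr => a; rewrite -dvdn_divisors // => am.
  have a0 := dvdn_gt0 m0 am.
  rewrite big_seq [RHS]big_seq; apply: eq_bigr => b; rewrite -dvdn_divisors // => bn.
  have g0 : 0 < gcdn a b by rewrite gcdn_gt0 a0.
  rewrite -[LHS]sum_totient_divisors // (@sum_divisors_sub _ m) //.
    by apply: eq_bigl => d; rewrite andbT dvdn_gcd.
  by move=> d; rewrite dvdn_gcd => /andP[da _] _; apply: dvdn_trans da am.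
have tauM d N c : 0 < N -> d %| N ->
    \sum_(a <- divisors N | d %| a) c = c * tau (N %/ d).
  move=> N0 dN; rewrite (sum_divisors_multiples (fun=> c)) // tauE big_distrr.
  by apply: eq_bigr => ? _; rewrite /= muln1.
transitivity (\sum_(a <- divisors m) \sum_(d <- divisors m | d %| a)
    \sum_(b <- divisors n | d %| b) totient d).
  apply: eq_bigr => a _; rewrite (exchange_big_dep (fun d => d %| a)) /=; last first.
    by move=> b d _ /andP[].
  by apply: eq_bigr => d da; apply: eq_bigl => b; rewrite da.
rewrite (exchange_big_dep xpredT) //= [RHS]big_mkcond big_seq [RHS]big_seq.
apply: eq_bigr => d; rewrite -dvdn_divisors // => dm.
case: ifP => dn; first by rewrite !tauM // mulnAC mulnA.
rewrite big1 // => a da; rewrite big1_seq // => b /andP[db].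
rewrite -dvdn_divisors // => bn; by rewrite (dvdn_trans db bn) in dn.
Qed.

(** For e > 0, the number of ordered factorisations of e^2 into four factors. *)
Definition square_tau (e : nat) : nat :=
  \sum_(u <- divisors (e ^ 2)) tau u * tau (e ^ 2 %/ u).

(** The function h of the overview. *)
Definition square_sqf_tau (e : nat) : nat :=
  \sum_(u <- divisors (e ^ 2)) sqf_tau u * tau (e ^ 2 %/ u).

Lemma square_tauE e : 0 < e ->
  square_tau e = \sum_(k <- divisors e) square_sqf_tau (e %/ k).
Proof.
move=> e0; have e20 : 0 < e ^ 2 by rewrite expn_gt0 e0.
transitivity (\sum_(u <- divisors (e ^ 2)) \sum_(k <- divisors e | k ^ 2 %| u)
    sqf_tau (u %/ k ^ 2) * tau (e ^ 2 %/ u)).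
  rewrite /square_tau big_seq [RHS]big_seq; apply: eq_bigr => u.
  by rewrite -dvdn_divisors // => ue; rewrite (tau_sqf e0 ue) big_distrl.
rewrite (exchange_big_dep xpredT) //= big_seq [RHS]big_seq; apply: eq_bigr => k.
rewrite -dvdn_divisors // => ke; have k0 := dvdn_gt0 e0 ke.
have k20 : 0 < k ^ 2 by rewrite expn_gt0 k0.
case/dvdnP: ke e0 e20 => f -> _ e20.
rewrite sum_divisors_multiples //; last by rewrite expnMn; apply: dvdn_mull.
rewrite expnMn !mulnK //.
by apply: eq_bigr => w _; rewrite mulKn // [_ * k ^ 2]mulnC divnMl.
Qed.

(** In Dirichlet convolutions, the left side is phi * [square_tau] = phi * (1 * h) = (phi * 1) * h,
    and phi * 1 is the identity function. *)
Lemma sum_num_subgroups_square r : 0 < r ->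
  \sum_(m <- divisors (r ^ 2)) num_subgroups m (r ^ 2 %/ m) =
  \sum_(d <- divisors r) d * square_sqf_tau (r %/ d).
Proof.
move=> r0; have r20 : 0 < r ^ 2 by rewrite expn_gt0 r0.
transitivity (\sum_(d <- divisors r) totient d * square_tau (r %/ d)).
  transitivity (\sum_(m <- divisors (r ^ 2))
      \sum_(d <- divisors r | (d %| m) && (d %| r ^ 2 %/ m))
        totient d * (tau (m %/ d) * tau (r ^ 2 %/ m %/ d))).
    rewrite big_seq [RHS]big_seq; apply: eq_bigr => m; rewrite -dvdn_divisors // => mr.
    have m0 := dvdn_gt0 r20 mr.
    have q0 : 0 < r ^ 2 %/ m by rewrite divn_gt0 // (dvdn_leq r20).
    rewrite num_subgroups_totient //.
    (* If d divides both m and r^2 / m, then d^2 | r^2, so d | r. *)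
    rewrite (@sum_divisors_sub m r) // => d dm dn.
    by rewrite -(@dvdn_pexp2r _ _ 2) // -(divnK mr) mulnC dvdn_mul.
  rewrite (exchange_big_dep xpredT) //= big_seq [RHS]big_seq; apply: eq_bigr => d.
  rewrite -dvdn_divisors // => dr; have d0 := dvdn_gt0 r0 dr.
  case/dvdnP: dr r0 r20 => e ->; rewrite muln_gt0 => /andP[e0 _] r20.
  have e20 : 0 < e ^ 2 by rewrite expn_gt0 e0.
  have key u : u %| e ^ 2 -> (e * d) ^ 2 %/ (d * u) = d * (e ^ 2 %/ u).
    move=> ue; have u0 := dvdn_gt0 e20 ue; case/dvdnP: ue => w ew.
    rewrite expnMn ew mulnK // (_ : w * u * d ^ 2 = d * w * (d * u)); last by ring.
    by rewrite mulnK // muln_gt0 d0.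
  rewrite (@sum_divisors_image _ (e ^ 2) d) // => [|u ue|m mr /andP[/dvdnP[u em]]].
  - rewrite mulnK // /square_tau big_distrr /= big_seq [RHS]big_seq.
    apply: eq_bigr => u; rewrite -dvdn_divisors // => ue.
    by rewrite key // !mulKn.
  - rewrite key // (dvdn_mulr u (dvdnn d)) (dvdn_mulr _ (dvdnn d)) andbT expnMn.
    by rewrite [e ^ 2 * _]mulnC dvdn_mul // -{1}[d]expn1 dvdn_exp2l.
  subst m => /dvdnP[v ev]; exists u; first by rewrite mulnC.
  have d20 : 0 < d ^ 2 by rewrite expn_gt0 d0.
  rewrite -(dvdn_pmul2r d20) -expnMn; apply/dvdnP; exists v.
  by rewrite -(divnK mr) ev; ring.
transitivity (\sum_(d <- divisors r) \sum_(k <- divisors (r %/ d))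
    totient d * square_sqf_tau (r %/ (d * k))).
  rewrite big_seq [RHS]big_seq; apply: eq_bigr => d; rewrite -dvdn_divisors // => dr.
  have q0 : 0 < r %/ d by rewrite divn_gt0 ?(dvdn_gt0 r0 dr) // (dvdn_leq r0).
  rewrite square_tauE // big_distrr /=.
  by apply: eq_bigr => k _; rewrite divnMA.
rewrite -(@sum_divisors_divisors r (fun d k => totient d * square_sqf_tau (r %/ (d * k)))) //.
rewrite big_seq [RHS]big_seq; apply: eq_bigr => m; rewrite -dvdn_divisors // => mr.
have m0 := dvdn_gt0 r0 mr.
rewrite -[X in _ = X * _](sum_totient_divisors m0) big_distrl /= big_seq [RHS]big_seq.
apply: eq_bigr => d; rewrite -dvdn_divisors // => dm.
by rewrite [d * _]mulnC divnK.
Qed.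

(** There are tau(e^2) terms, each at most tau(e^2)^2, and tau(e^2) <= tau(e)^2. *)
Lemma square_sqf_tau_le e : 0 < e -> square_sqf_tau e <= tau e ^ 6.
Proof.
move=> e0; have e20 : 0 < e ^ 2 by rewrite expn_gt0 e0.
have le2 : tau (e ^ 2) <= tau e ^ 2 by apply: tau_mul.
apply: (@leq_trans (\sum_(u <- divisors (e ^ 2)) tau (e ^ 2) * tau (e ^ 2))).
  rewrite /square_sqf_tau big_seq [leqRHS]big_seq; apply: leq_sum => u.
  rewrite -dvdn_divisors // => ue; apply: leq_mul.
    by apply: leq_trans (sqf_tau_le _) _; apply: tau_dvd.
  by apply: tau_dvd => //; apply: dvdn_div.
rewrite big_const_seq count_predT iter_addn_0 -/(tau _).
rewrite (_ : tau e ^ 6 = tau e ^ 2 * tau e ^ 2 * tau e ^ 2); first by rewrite !leq_mul.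
by rewrite -!expnD.
Qed.

End SquareConvolution.

(** * From pairs with square product to a sum over square roots *)

Section SquareProductSum.
Local Open Scope nat_scope.

Lemma sum_pairs_square_product (s : nat -> nat -> nat) X r : 0 < r -> r ^ 2 <= X ->
  \sum_(1 <= m1 < X.+1) \sum_(1 <= m2 < X.+1 | m1 * m2 == r ^ 2) s m1 m2 =
  \sum_(m <- divisors (r ^ 2)) s m (r ^ 2 %/ m).
Proof.
move=> r0 rX; have r20 : 0 < r ^ 2 by rewrite expn_gt0 r0.
rewrite (@sum_divisors_pred_range _ _ X) ?r20 // [RHS]big_mkcond.
apply: eq_big_nat => m1 /andP[m10 _]; case: ifP => mr; last first.
  by rewrite big1 // => m2 /eqP e; rewrite -e dvdn_mulr in mr.
rewrite big_mkcond (bigD1_seq (r ^ 2 %/ m1)) ?iota_uniq //=; last first.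
  rewrite mem_index_iota divn_gt0 // (dvdn_leq r20) //= ltnS.
  by apply: leq_trans rX; apply: leq_div.
rewrite mulnC divnK // eqxx big1 ?addn0 // => m2 ne; case: eqP => // e.
by rewrite -e mulKn // eqxx in ne.
Qed.

(** The hypothesis makes Y the integer square root of X; pairs are sorted by the unique root r of
    their product. *)
Lemma sum_square_products (s : nat -> nat -> nat) X Y :
    (forall r, (r <= Y) = (r ^ 2 <= X)) ->
  \sum_(1 <= m1 < X.+1) \sum_(1 <= m2 < X.+1
    | (m1 * m2 <= X) && ((m1 * m2)%N \in kth_powers 2)) s m1 m2 =
  \sum_(1 <= r < Y.+1) \sum_(m <- divisors (r ^ 2)) s m (r ^ 2 %/ m).
Proof.
move=> YX.
transitivity (\sum_(1 <= r < Y.+1) \sum_(1 <= m1 < X.+1)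
    \sum_(1 <= m2 < X.+1 | m1 * m2 == r ^ 2) s m1 m2); last first.
  by apply: eq_big_nat => r /andP[r0]; rewrite ltnS YX; apply: sum_pairs_square_product.
rewrite exchange_big /=; apply: eq_big_nat => m1 /andP[m10 _].
rewrite (exchange_big_dep xpredT) //= big_mkcond; apply: eq_big_nat => m2 /andP[m20 _].
case: ifP => [/andP[le /set_mem[r er]]|cond]; last first.
  rewrite big1_seq // => r /andP[/eqP e]; rewrite mem_index_iota ltnS YX -e => /andP[_ le].
  by move/negP: cond; case; rewrite le /=; apply/mem_set; exists r.
have r0 : 0 < r.
  have : 0 < r ^ 2 by rewrite -er muln_gt0 m10.
  by rewrite expn_gt0 orbF.
rewrite big_mkcond (bigD1_seq r) ?iota_uniq //= ?er ?eqxx; last first.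
  by rewrite mem_index_iota r0 ltnS YX -er.
rewrite big1 ?addn0 // => q ne; case: eqP => // /eqP.
by rewrite eqn_exp2r // eq_sym (negbTE ne).
Qed.

(** Writing r = e d and summing over d innermost leaves a triangular number, which can be estimated
    precisely. *)
Lemma sum_subgroups_square_products X Y :
    (forall r, (r <= Y) = (r ^ 2 <= X)) ->
  \sum_(1 <= m1 < X.+1) \sum_(1 <= m2 < X.+1
    | (m1 * m2 <= X) && ((m1 * m2)%N \in kth_powers 2)) num_subgroups m1 m2 =
  \sum_(1 <= e < Y.+1) square_sqf_tau e * \sum_(1 <= d < (Y %/ e).+1) d.
Proof.
move=> YX; rewrite (sum_square_products _ YX).
transitivity (\sum_(1 <= r < Y.+1) \sum_(e <- divisors r) r %/ e * square_sqf_tau e).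
  apply: eq_big_nat => r /andP[r0 _]; rewrite sum_num_subgroups_square //.
  rewrite -[LHS]sum_divisors_rev //.
  rewrite big_seq [RHS]big_seq; apply: eq_bigr => e; rewrite -dvdn_divisors // => er.
  by rewrite -{2}(divnK er) mulKn // divn_gt0 ?(dvdn_gt0 r0 er) // (dvdn_leq r0).
rewrite (@sum_range_divisors _ Y (fun e k => k * square_sqf_tau e)).
by apply: eq_bigr => e _; rewrite big_distrr /=; apply: eq_bigr => d _; rewrite mulnC.
Qed.

End SquareProductSum.

(** * Real estimates and convergence *)

Section Analysis.
Variable R : realType.
Implicit Types (s x y z : R) (n N e Y : nat).

Lemma subgroup_sum_square x : 0 <= x ->
  subgroup_sum 2 x = \sum_(1 <= e < (Num.truncn (Num.sqrt x)).+1)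
    (square_sqf_tau e)%:R * (\sum_(1 <= d < (Num.truncn (Num.sqrt x) %/ e)%N.+1) d)%:R.
Proof.
move=> x0; set Y := Num.truncn (Num.sqrt x); set X := Num.truncn x.
have YX r : (r <= Y)%N = (r ^ 2 <= X)%N.
  rewrite !truncn_ge_nat ?sqrtr_ge0 // natrX -[in RHS](sqr_sqrtr x0).
  by rewrite ler_pXn2r ?nnegrE ?sqrtr_ge0.
transitivity ((\sum_(1 <= m1 < X.+1) \sum_(1 <= m2 < X.+1
    | (m1 * m2 <= X)%N && ((m1 * m2)%N \in kth_powers 2)) num_subgroups m1 m2)%:R : R).
  rewrite /subgroup_sum natr_sum; apply: eq_bigr => m1 _.
  by rewrite natr_sum; apply: eq_bigl => m2; rewrite truncn_ge_nat.
rewrite (sum_subgroups_square_products YX) natr_sum.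
by apply: eq_bigr => e _; rewrite natrM.
Qed.

(** Twice the sum is N (N + 1), which lies between z (z - 1) and z (z + 1). *)
Lemma triangular_sum_approx N z : N%:R <= z < N%:R + 1 ->
  `|(\sum_(1 <= d < N.+1) d)%:R - z ^+ 2 / 2| <= z / 2.
Proof.
have -> : (\sum_(1 <= d < N.+1) d)%:R = N%:R * (N%:R + 1) / 2 :> R.
  elim: N => [|N IH]; first by rewrite big_geq // !mul0r.
  by rewrite big_nat_recr //= natrD IH -natr1; field.
have N0 : 0 <= N%:R :> R by [].
by case/andP=> h1 h2; rewrite ler_norml; apply/andP; split; nra.
Qed.

Lemma ler_powR_exp_le0 (r a b : R) : r <= 0 -> 0 < a <= b -> b `^ r <= a `^ r.
Proof.
move=> r0 /andP[a0 ab]; have b0 := lt_le_trans a0 ab.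
rewrite -[r]opprK powRN [leRHS]powRN lef_pV2 ?posrE ?powR_gt0 //.
by apply: ge0_ler_powR; rewrite ?oppr_ge0 ?nnegrE // ltW.
Qed.

(** Pairing 2n with 2n + 1 gives S(N) <= S(2N + 1) <= 1 + 2 q S(N) with q = 2^(-s), and 2 q < 1
    bounds S(N) by 1 / (1 - 2 q). *)
Lemma sum_powRN_bounded s : 1 < s ->
  exists K : R, forall N, \sum_(1 <= n < N.+1) n%:R `^ (- s) <= K.
Proof.
move=> s1; pose S N : R := \sum_(1 <= n < N.+1) n%:R `^ (- s).
have Sodd N : S N.*2.+1 = 1 + \sum_(1 <= n < N.+1)
    (n.*2%:R `^ (- s) + n.*2.+1%:R `^ (- s)).
  elim: N => [|N IH]; first by rewrite /S big_nat1 powR1 big_geq // addr0.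
  rewrite [in RHS]big_nat_recr //= addrA -IH /S doubleS big_nat_recr //= big_nat_recr //=.
  by rewrite addrA.
pose q : R := 2 `^ (- s).
have q1 : 2 * q < 1.
  rewrite /q powRN ltr_pdivrMr ?powR_gt0 // mul1r.
  rewrite -(@mulr_powRB1 _ 2) // ?(lt_trans ltr01) // ltr_pMr //.
  have : 1 `^ (s - 1) < 2 `^ (s - 1) :> R.
    by apply: gt0_ltr_powR; rewrite ?nnegrE ?subr_gt0 // ltr1n.
  by rewrite powR1.
have Sle N : S N.*2.+1 <= 1 + 2 * q * S N.
  rewrite Sodd lerD2l /S big_distrr /=; apply: ler_sum_nat => n /andP[n0 _].
  have : n.*2.+1%:R `^ (- s) <= n.*2%:R `^ (- s) :> R.
    apply: ler_powR_exp_le0; first by rewrite oppr_le0; lra.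
    by rewrite ltr0n double_gt0 n0 ler_nat leqnSn.
  have -> : n.*2%:R `^ (- s) = q * n%:R `^ (- s).
    by rewrite -mul2n natrM powRM.
  lra.
exists ((1 - 2 * q)^-1) => N.
have : S N <= S N.*2.+1.
  rewrite /S [leRHS](@big_cat_nat _ _ _ N.+1) //=; last by rewrite !ltnS -addnn leqW ?leq_addr.
  by rewrite lerDl sumr_ge0 // => n _; rewrite powR_ge0.
move/le_trans/(_ (Sle N)) => h; rewrite -/(S N) -[leRHS]mul1r ler_pdivlMr; lra.
Qed.

(** One factor tau(n) becomes a sum over a | n; in the others tau(n) <= tau(a) tau(n / a). The
    resulting sum over a b <= N is at most the square of the bound for k. *)
Lemma sum_tau_exp_powRN_bounded s k : 1 < s ->
  exists K : R, forall N, \sum_(1 <= n < N.+1) (tau n ^ k)%:R * n%:R `^ (- s) <= K.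
Proof.
move=> s1; elim: k => [|k [K IH]].
  have [K h] := sum_powRN_bounded s1; exists K => N.
  by under eq_bigr do rewrite expn0 mul1r.
have ge0 (n : nat) : 0 <= (tau n ^ k)%:R * n%:R `^ (- s) by rewrite mulr_ge0 ?powR_ge0.
have K0 : 0 <= K by apply: le_trans (IH 0%N); rewrite big_geq.
exists (K * K) => N.
apply: (@le_trans _ _ (\sum_(1 <= n < N.+1) \sum_(a <- divisors n)
    ((tau a ^ k)%:R * a%:R `^ (- s)) * ((tau (n %/ a) ^ k)%:R * (n %/ a)%:R `^ (- s)))).
  apply: ler_sum_nat => n /andP[n0 _].
  rewrite expnS natrM -mulrA {1}tauE natr_sum big_distrl /=.
  rewrite big_seq [leRHS]big_seq; apply: ler_sum => a; rewrite -dvdn_divisors // => an.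
  have a0 := dvdn_gt0 n0 an.
  have na0 : (0 < n %/ a)%N by rewrite divn_gt0 // (dvdn_leq n0).
  rewrite mul1r mulrACA -powRM ?ler0n // -!natrM -expnMn [(a * _)%N]mulnC divnK //.
  rewrite ler_wpM2r ?powR_ge0 // ler_nat.
  have le : (tau n <= tau a * tau (n %/ a))%N.
    by rewrite -{1}(divnK an) mulnC tau_mul.
  by case: (k) => // j; rewrite leq_exp2r.
rewrite (@sum_range_divisors _ N (fun a b =>
  ((tau a ^ k)%:R * a%:R `^ (- s)) * ((tau b ^ k)%:R * b%:R `^ (- s)))).
apply: (@le_trans _ _ (\sum_(1 <= a < N.+1) (tau a ^ k)%:R * a%:R `^ (- s) * K)).
  by apply: ler_sum => a _; rewrite -big_distrr /= ler_wpM2l.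
by rewrite -big_distrl /= ler_wpM2r.
Qed.

Lemma sum_square_sqf_tau_bounded s : 1 < s ->
  exists2 A : R, 0 <= A &
    forall N, \sum_(1 <= n < N.+1) (square_sqf_tau n)%:R * n%:R `^ (- s) <= A.
Proof.
move=> s1; have [A h] := sum_tau_exp_powRN_bounded 6 s1; exists A.
  by apply: le_trans (h 0%N); rewrite big_geq.
move=> N; apply: le_trans (h N); apply: ler_sum_nat => n /andP[n0 _].
by rewrite ler_wpM2r ?powR_ge0 // ler_nat square_sqf_tau_le.
Qed.

(** For n >= m, n^(-2) = n^(-s) n^(s-2) <= n^(-s) m^(s-2), because s < 2. This bounds the partial
    sums, whose limit is c, and also the tail. *)
Lemma sum_inv_square_limit (h : nat -> R) s A : s < 2 -> 0 <= A ->
    (forall n, 0 <= h n) ->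
    (forall N, \sum_(1 <= n < N.+1) h n * n%:R `^ (- s) <= A) ->
  exists c : R, forall N,
    0 <= c - \sum_(1 <= n < N.+1) h n / n%:R ^+ 2 <= A * N.+1%:R `^ (s - 2).
Proof.
move=> s2 A0 h0 hA; pose u N := \sum_(1 <= n < N.+1) h n / n%:R ^+ 2.
have term n : 0 <= h n / n%:R ^+ 2 by rewrite divr_ge0 ?exprn_ge0.
have term2 n m : (0 < m <= n)%N -> h n / n%:R ^+ 2 <= h n * n%:R `^ (- s) * m%:R `^ (s - 2).
  case/andP=> m0 mn; have n0 := leq_trans m0 mn.
  rewrite -mulrA ler_wpM2l // -powR_invn ?ler0n //.
  have -> : n%:R `^ (- 2%:R) = n%:R `^ (- s) * n%:R `^ (s - 2) :> R.
    by rewrite -powRD ?pnatr_eq0 -?lt0n ?n0 ?implybT // addrA addNr add0r.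
  rewrite ler_wpM2l ?powR_ge0 //.
  by apply: ler_powR_exp_le0; [lra | rewrite ltr0n m0 ler_nat].
have uD m n : (m <= n)%N -> u m <= u n <= u m + A * m.+1%:R `^ (s - 2).
  move=> mn; rewrite /u (@big_cat_nat _ _ _ m.+1 1 n.+1) //=.
  rewrite lerDl sumr_ge0 //= lerD2l.
  apply: (@le_trans _ _ (\sum_(m.+1 <= i < n.+1) h i * i%:R `^ (- s) * m.+1%:R `^ (s - 2))).
    by apply: ler_sum_nat => i /andP[mi _]; apply: term2.
  rewrite -big_distrl /= ler_wpM2r ?powR_ge0 //; apply: le_trans (hA n).
  rewrite [leRHS](@big_cat_nat _ _ _ m.+1) //= lerDr sumr_ge0 // => i _.
  by rewrite mulr_ge0 ?powR_ge0.
have nd : nondecreasing_seq u by move=> m n /uD/andP[].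
have cu : cvgn u.
  apply: nondecreasing_is_cvgn => //; exists (u 0%N + A * 1%:R `^ (s - 2)) => _ [n _ <-].
  by have /andP[] := uD 0%N n (leq0n n).
exists (limn u) => N; rewrite subr_ge0; apply/andP; split.
  exact: nondecreasing_cvgn_le.
rewrite lerBlDl; apply: limr_le => //; near=> n.
have /uD/andP[] // : (N <= n)%N by near: n; exact: nbhs_infty_ge.
Unshelve. all: by end_near.
Qed.

(** Here n^(-1) = n^(-s) n^(s-1) <= n^(-s) y^(s-1), because n <= y and s >= 1. *)
Lemma ler_sum_inv (h : nat -> R) s A y Y : 1 <= s -> (forall n, 0 <= h n) ->
    Y%:R <= y ->
    \sum_(1 <= n < Y.+1) h n * n%:R `^ (- s) <= A ->
  \sum_(1 <= n < Y.+1) h n / n%:R <= A * y `^ (s - 1).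
Proof.
move=> s1 h0 Yy hA; have y0 : 0 <= y by apply: le_trans Yy.
apply: le_trans (ler_wpM2r (powR_ge0 _ _) hA); rewrite big_distrl /=.
apply: ler_sum_nat => n /andP[n0]; rewrite ltnS => nY.
rewrite -mulrA ler_wpM2l // -powR_inv1 ?ler0n //.
have -> : n%:R `^ (-1) = n%:R `^ (- s) * n%:R `^ (s - 1) :> R.
  by rewrite -powRD ?pnatr_eq0 -?lt0n ?n0 ?implybT // addrA addNr add0r.
rewrite ler_wpM2l ?powR_ge0 //.
apply: ge0_ler_powR; rewrite ?nnegrE ?subr_ge0 //.
by apply: le_trans Yy; rewrite ler_nat.
Qed.

End Analysis.

(** * The asymptotic formula *)

Theorem theorem1p1 (R : realType) :
  exists c2 : R, forall eps : R, 0 < eps ->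
    exists C : R, forall x : R, 1 <= x ->
      `|subgroup_sum 2 x - c2 * x| <= C * x `^ (19 / 28 + eps).
Proof.
(* With y = sqrt x, y^s = x^(s/2), and s / 2 = 19/28. *)
pose s : R := 19 / 14; pose h n : R := (square_sqf_tau n)%:R.
have s1 : 1 < s by rewrite /s; lra.
have s2 : s < 2 by rewrite /s; lra.
have h0 n : 0 <= h n by [].
have [A A0 hA] := sum_square_sqf_tau_bounded s1.
have [c hc] := sum_inv_square_limit s2 A0 h0 hA.
(* c is the sum of h(e) / e^2, halved because a triangular sum up to z is about z^2 / 2. The
   constant A does not depend on [eps]. *)
exists (c / 2) => eps eps0; exists A => x x1.
set y := Num.sqrt x; pose Y := Num.truncn y.
have x0 : 0 <= x by apply: le_trans x1.
have xE : x = y ^+ 2 by rewrite sqr_sqrtr.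
have y1 : 1 <= y by rewrite -sqrtr1 ler_sqrt // (lt_le_trans ltr01).
have y0 : 0 < y by apply: lt_le_trans y1.
have /andP[Yy yY] : Y%:R <= y < Y.+1%:R by apply: truncn_itv; apply: ltW.
(* The error splits into the triangular approximation errors and the tail of the series for c. *)
have -> : subgroup_sum 2 x - c / 2 * x =
    \sum_(1 <= e < Y.+1) h e * ((\sum_(1 <= d < (Y %/ e)%N.+1) d)%:R - (y / e%:R) ^+ 2 / 2)
    - y ^+ 2 / 2 * (c - \sum_(1 <= e < Y.+1) h e / e%:R ^+ 2).
  rewrite subgroup_sum_square // -/y -/Y.
  under [X in _ = X - _]eq_bigr do rewrite mulrBr.
  rewrite sumrB xE mulrBr.
  have -> : \sum_(1 <= e < Y.+1) h e * ((y / e%:R) ^+ 2 / 2) =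
      y ^+ 2 / 2 * \sum_(1 <= e < Y.+1) h e / e%:R ^+ 2.
    by rewrite big_distrr /=; apply: eq_bigr => e _; rewrite expr_div_n; ring.
  by rewrite /h; ring.
have powE : y `^ s = x `^ (19 / 28).
  by rewrite /y -powR12_sqrt // -powRrM; congr (_ `^ _); rewrite /s; field.
have final : A * y `^ s <= A * x `^ (19 / 28 + eps).
  by rewrite ler_wpM2l // powE ler_powR // lerDl ltW.
apply: le_trans final; apply: le_trans (ler_normB _ _) _.
(* Both summands equal A y^s / 2, one for each error. *)
have -> : A * y `^ s = y / 2 * (A * y `^ (s - 1)) + y ^+ 2 / 2 * (A * y `^ (s - 2)).
  have e1 : y `^ s = y * y `^ (s - 1) by rewrite mulr_powRB1 ?ltW // (lt_trans ltr01).
  have e2 : y `^ s = y ^+ 2 * y `^ (s - 2).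
    rewrite -powR_mulrn ?ltW // -powRD ?(gt_eqF y0) ?implybT //.
    by congr (_ `^ _); ring.
  have -> : y / 2 * (A * y `^ (s - 1)) = A / 2 * y `^ s by rewrite e1; ring.
  have -> : y ^+ 2 / 2 * (A * y `^ (s - 2)) = A / 2 * y `^ s by rewrite e2; ring.
  by field.
have y20 : 0 <= y / 2 by rewrite divr_ge0 // ltW.
have yy20 : 0 <= y ^+ 2 / 2 by rewrite divr_ge0 // exprn_ge0 // ltW.
apply: lerD.
  apply: le_trans (ler_norm_sum _ _ _) _.
  apply: (@le_trans _ _ (y / 2 * \sum_(1 <= e < Y.+1) h e / e%:R)).
    rewrite big_distrr /=; apply: ler_sum_nat => e /andP[e0 _].
    rewrite normrM ger0_norm // [leRHS](_ : _ = h e * (y / e%:R / 2)); last by ring.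
    rewrite ler_wpM2l //; apply: triangular_sum_approx.
    have e0' : 0 < e%:R :> R by rewrite ltr0n.
    (* The integer quotient of Y by e is the integer part of y / e. *)
    rewrite ler_pdivlMr // ltr_pdivrMr // natr1 -!natrM; apply/andP; split.
      by apply: le_trans Yy; rewrite ler_nat leq_divM.
    by apply: lt_le_trans yY _; rewrite ler_nat ltn_ceil.
  by rewrite ler_wpM2l //; apply: ler_sum_inv => //; apply: ltW.
have /andP[c0 cA] := hc Y.
rewrite ger0_norm; last exact: mulr_ge0.
rewrite ler_wpM2l //; apply: le_trans cA _.
(* As y < Y + 1 and s - 2 < 0, (Y + 1)^(s-2) <= y^(s-2). *)
by rewrite ler_wpM2l // ler_powR_exp_le0 ?y0 ?ltW ?subr_lt0.
Qed.
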